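(* Let $\Omega\subset\mathbb{R}^d$, $d\in\{2,3\}$, be an open connected bounded domain with smooth boundary, and let $W$ be a given smooth real-valued function on $\partial\Omega$. Let $Z_1>0$ and $I_2>0$ be given (independent of $\epsilon$). For each $\epsilon>0$ let $\Phi^*_\epsilon$ be the unique solution of the (nonlocal) Poisson-Boltzmann equation $$-\epsilon\Delta\Phi^*_\epsilon=\rho^*_\epsilon\quad\text{in }\Omega,\qquad \rho^*_\epsilon=\frac{e^{-\Phi^*_\epsilon}}{Z_1}-I_2\frac{e^{\Phi^*_\epsilon}}{\int_\Omega e^{\Phi^*_\epsilon}\,dx},$$ with boundary condition $\Phi^*_\epsilon|_{\partial\Omega}=W$. Then for each compact $K\subset\Omega$, $$\lim_{\epsilon\to0}\ \sup_{x\in K}|\rho^*_\epsilon(x)|=0.$$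
   Context: The function $W$ does not depend on $\epsilon$. ''Solution'' means a smooth (classical) solution on $\overline\Omega$; for each $\epsilon>0$ a unique solution of this boundary value problem exists. *)

(* Defs.v *)
(* R^n is the type of row vectors of length n over an arbitrary R : realType. *)
From HB Require Import structures.
From mathcomp Require Import all_boot all_order all_algebra.
From mathcomp Require Import all_classical all_reals all_analysis.

Set Implicit Arguments.
Unset Strict Implicit.
Unset Printing Implicit Defensive.

Import Order.TTheory GRing.Theory Num.Theory.
Import numFieldNormedType.Exports.

Local Open Scope classical_set_scope.
Local Open Scope ring_scope.

Section rV_measurable.
Context {R : realType}.
Variable n : nat.

(* The product sigma-algebra, i.e. the Borel sets of R^n. *)
Let coord (i : 'I_n) (x : 'rV[R]_n) : R := x ord0 i.

HB.instance Definition _ := @isMeasurable.Build default_measure_display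
  'rV[R]_n (g_sigma_preimage coord)
  (@sigma_algebra0 _ _ _) (@sigma_algebraC _ _) (@sigma_algebra_bigcup _ _ _).

Lemma measurable_coord (i : 'I_n) :
  measurable_fun [set: 'rV[R]_n] (fun x : 'rV[R]_n => x ord0 i).
Proof.
move=> _ Y mY; rewrite setTI; apply: sub_sigma_algebra => /=.
rewrite -bigcup_seq/=; exists i => /=; first by rewrite mem_index_enum.
by exists Y => //; rewrite setTI.
Qed.

Lemma measurable_fun_rV d (T : measurableType d) (f : T -> 'rV[R]_n) :
  (forall i, measurable_fun [set: T] (fun t => f t ord0 i)) ->
  measurable_fun [set: T] f.
Proof.
move=> mf _ A mA.
have : g_sigma_preimage (fun i => coord i \o f) `<=` measurable.
  apply: smallest_sub; first exact: sigma_algebra_measurable.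
  move=> B; rewrite -bigcup_seq/= => -[i _] [C mC <-].
  exact: mf.
by apply; rewrite g_sigma_preimage_comp; exists A.
Qed.

End rV_measurable.

Section rV_cons.
Context {R : realType}.
Variable n : nat.

Definition cons_rV (p : measurableTypeR R * 'rV[R]_n) : 'rV[R]_n.+1 :=
  \row_(i < n.+1) if unlift ord0 i is Some j then p.2 ord0 j else p.1.

Lemma measurable_cons_rV :
  measurable_fun [set: measurableTypeR R * 'rV[R]_n] cons_rV.
Proof.
apply: measurable_fun_rV => i; under eq_fun do rewrite mxE.
case: (unlift ord0 i) => [j|]; last first.
  by move=> mT Y mY; exact: (@measurable_fst _ _ (measurableTypeR R) 'rV[R]_n mT Y mY).
exact: (measurableT_comp (f := fun x : 'rV[R]_n => x ord0 j) (measurable_coord j)).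
Qed.

Variable mu : {sigma_finite_measure set 'rV[R]_n -> \bar R}.

Definition cons_measure : set 'rV[R]_n.+1 -> \bar R :=
  pushforward (lebesgue_measure \x mu)%E cons_rV.

Let cons_measure0 : cons_measure set0 = 0%E.
Proof. by rewrite /cons_measure /pushforward preimage_set0 measure0. Qed.

Let cons_measure_ge0 A : (0 <= cons_measure A)%E.
Proof. exact: (measure_ge0 (lebesgue_measure \x mu)%E). Qed.

Let cons_measure_sigma_additive : semi_sigma_additive cons_measure.
Proof.
move=> F mF tF mUF; rewrite /cons_measure /pushforward preimage_bigcup.
apply: measure_semi_sigma_additive.
- by move=> k; rewrite -[X in measurable X]setTI; exact: measurable_cons_rV.
- apply/trivIsetP => /= i j _ _ ij; rewrite -preimage_setI.
  by move/trivIsetP : tF => /(_ _ _ _ _ ij) ->//; rewrite preimage_set0.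
- rewrite -preimage_bigcup -[X in measurable X]setTI.
  exact: measurable_cons_rV.
Qed.

HB.instance Definition _ := isMeasure.Build _ _ _ cons_measure
  cons_measure0 cons_measure_ge0 cons_measure_sigma_additive.

Let split_rV (x : 'rV[R]_n.+1) : measurableTypeR R * 'rV[R]_n :=
  (x ord0 ord0, \row_j x ord0 (lift ord0 j)).

Let cons_rVK : cancel cons_rV split_rV.
Proof.
move=> [a y]; rewrite /split_rV /cons_rV !mxE unlift_none; congr pair.
by apply/rowP => j; rewrite !mxE liftK.
Qed.

Let measurable_split_rV : measurable_fun [set: 'rV[R]_n.+1] split_rV.
Proof.
apply/measurable_fun_pairP; split; first exact: measurable_coord.
apply: measurable_fun_rV => i /=; under eq_fun do rewrite mxE.
exact: measurable_coord.
Qed.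

Let cons_measure_sigma_finite : sigma_finite setT cons_measure.
Proof.
have /sigma_finiteP[F [TF ndF Foo]] := sigma_finiteT (@lebesgue_measure R).
have /sigma_finiteP[G [TG ndG Goo]] := sigma_finiteT mu.
exists (fun k => split_rV @^-1` (F k `*` G k)).
  apply/seteqP; split=> // x _; have [i _ Fi] : (\bigcup_k F k) (split_rV x).1.
    by rewrite -TF.
  have [j _ Gj] : (\bigcup_k G k) (split_rV x).2 by rewrite -TG.
  exists (maxn i j) => //; split.
    by move: Fi; exact/subsetPset/ndF/leq_maxl.
  by move: Gj; exact/subsetPset/ndG/leq_maxr.
move=> k; have [mF Fk] := Foo k; have [mG Gk] := Goo k; split.
  rewrite -[X in measurable X]setTI; apply: measurable_split_rV => //.
  exact: measurableX.
rewrite /cons_measure /pushforward -comp_preimage.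
rewrite (_ : split_rV \o cons_rV = id); last exact/funext/cons_rVK.
by rewrite preimage_id product_measure1E// lte_mul_pinfty// ge0_fin_numE.
Qed.

HB.instance Definition _ := Measure_isSigmaFinite.Build _ _ _ cons_measure
  cons_measure_sigma_finite.

End rV_cons.

(* n-dimensional Lebesgue measure as the n-fold product of the one-dimensional
   one: R^0 has unit mass, and R^(n+1) is identified with R * R^n. *)
Fixpoint lebesgue_rV (R : realType) (n : nat) :
    {sigma_finite_measure set 'rV[R]_n -> \bar R} :=
  match n with
  | 0 => \d_(0 : 'rV[R]_0)
  | m.+1 => cons_measure (lebesgue_rV R m)
  end.

Section smoothness.
Context {R : realType}.
Variable n : nat.
Implicit Types (U S : set 'rV[R]_n) (f : 'rV[R]_n -> R).

Definition pderiv (i : 'I_n) f : 'rV[R]_n -> R :=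
  fun x => 'D_(delta_mx ord0 i) f x.

Definition pderivs (s : seq 'I_n) f : 'rV[R]_n -> R := foldr pderiv f s.

Definition laplacian f (x : 'rV[R]_n) : R := \sum_(i < n) pderivs [:: i; i] f x.

(* C^oo(U), meant for open U: 'D_v is a total operator, so the existence of
   each derivative is required separately. *)
Definition smooth_on U f : Prop :=
  forall (s : seq 'I_n) (x : 'rV[R]_n), U x ->
    {for x, continuous (pderivs s f)} /\
    forall i : 'I_n, derivable (pderivs s f) x (delta_mx ord0 i).

(* C^oo of the closure of U: f is smooth in U and continuous up to the boundary,
   and all its partial derivatives extend continuously to the closure. *)
Definition smooth_on_closure U f : Prop :=
  [/\ smooth_on U f,
      {within closure U, continuous f} &
      forall s : seq 'I_n, exists2 g : 'rV[R]_n -> R,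
        {within closure U, continuous g} &
        forall x, U x -> g x = pderivs s f x].

(* Smoothness of a function on an arbitrary subset S: near each point of S it
   is the restriction of a smooth function of the ambient space. Only the
   values of f on S matter. *)
Definition smooth_on_subset S f : Prop :=
  forall x0, S x0 -> exists2 r : R, 0 < r &
    exists2 g : 'rV[R]_n -> R, smooth_on (ball x0 r) g &
      forall x, ball x0 r x -> S x -> f x = g x.

Definition boundary U : set 'rV[R]_n := closure U `\` U°.

End smoothness.

(* Near each of its boundary points, Omega is the region strictly above the
   graph of a smooth function of n - 1 variables, up to the choice of the
   vertical axis i and of its orientation (-1) ^+ b. *)
Definition smooth_boundary (R : realType) (n : nat) (Omega : set 'rV[R]_n) :
    Prop :=
  forall x0, boundary Omega x0 ->
    exists (i : 'I_n) (b : bool) (gamma : 'rV[R]_n.-1 -> R) (r : R),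
      [/\ 0 < r, smooth_on setT gamma &
          forall x, ball x0 r x ->
            (Omega x <-> gamma (col' i x) < (-1) ^+ b * x ord0 i)].

Section poisson_boltzmann.
Context {R : realType}.
Variable d : nat.
Implicit Types (Omega : set 'rV[R]_d) (W Phi : 'rV[R]_d -> R).

Definition charge_density (Z1 I2 : R) Omega Phi (x : 'rV[R]_d) : R :=
  expR (- Phi x) / Z1 -
  I2 * (expR (Phi x) / \int[lebesgue_rV R d]_(y in Omega) expR (Phi y)).

Definition PB_solution (Z1 I2 : R) Omega W (eps : R) Phi : Prop :=
  [/\ smooth_on_closure Omega Phi,
      forall x, Omega x ->
        - eps * laplacian Phi x = charge_density Z1 I2 Omega Phi x &
      forall x, boundary Omega x -> Phi x = W x].

(* The supremum of |f| over K in [0, +oo]; in particular 0 when K is empty. *)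
Definition sup_abs (K : set 'rV[R]_d) (f : 'rV[R]_d -> R) : \bar R :=
  maxe 0%E (ereal_sup [set `|f x|%:E | x in K]).

End poisson_boltzmann.

(* Main.v *)
Require Import Defs.
From HB Require Import structures.
From mathcomp Require Import all_boot all_order all_algebra.
From mathcomp Require Import all_classical all_reals all_analysis.
From mathcomp Require Import ring lra.

Set Implicit Arguments.
Unset Strict Implicit.
Unset Printing Implicit Defensive.

Import Order.TTheory GRing.Theory Num.Theory.
Import numFieldNormedType.Exports.

Local Open Scope classical_set_scope.
Local Open Scope ring_scope.

(** Put [C := \int_Omega exp Phi] and [f t := exp (- t) / Z1 - I2 * exp t / C].
    For a fixed [eps] the number [C] is a nonnegative constant, so that the
    equation is local, [- eps * laplacian Phi = f (Phi)], with [f]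
    nonincreasing. Two applications of the maximum principle give the result.

    Interior estimate ([interior_estimate]). Suppose that [|Phi| <= A] on a
    closed cube of half-side [s] around [x0], contained in [Omega]. With
    [c := 3 * A / s ^ 2] the function [y |-> Phi y - c * |y - x0| ^ 2], where
    the norm is the Euclidean one, cannot be maximal on the boundary of the
    cube: there it is at most [A - 3 * A < - A], which is at most its value at
    [x0]. At an interior maximum [x] one has [Phi x0 <= Phi x] and
    [laplacian Phi x <= 2 * n * c], so, [f] being nonincreasing,
    [f (Phi x0) >= f (Phi x) = - eps * laplacian Phi x >= - 2 * n * c * eps].
    Applied to [Phi] and [- Phi] this bounds the charge density at [x0] by a
    multiple of [eps], uniformly on [K] as soon as [A] is free of [eps].

    Uniform bound ([PB_solution_bounds]). Let [x] be a maximum of [Phi] over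
    the closure of [Omega]. If [x] is on the boundary, [Phi x] is a value of
    [W]. Otherwise [laplacian Phi x <= 0], so the charge density at [x] is
    nonnegative; since [C <= |Omega| * exp (Phi x)], where
    [|Omega|] is the measure of [Omega], this reads
    [I2 / |Omega| <= I2 * exp (Phi x) / C <= exp (- Phi x) / Z1], that is
    [Phi x <= ln (|Omega| / (Z1 * I2))]. Minima are symmetric. The nonlocal
    term thus helps: the bound is free of [eps].

    The measure theory needed is that open sets are measurable for
    [lebesgue_rV] and that nonempty bounded open sets have positive finite
    measure. *)

(** * Second derivatives at a point of contact with a parabola *)

(** Otherwise [psi t := phi t - (a * t + b * t ^+ 2)], which has a local
    maximum and hence a critical point at [0], would have an increasing
    derivative at [0]: it would be positive on the right of [0], and the mean
    value theorem would give [psi k > psi 0] for small [k]. *)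
Lemma second_derivative_le (R : realType) (phi : R -> R) (a b : R) :
    (\forall t \near 0, derivable phi t 1) ->
    derivable ('D_1 phi) 0 1 ->
    (\forall t \near 0, phi t <= phi 0 + a * t + b * t ^+ 2) ->
  'D_1 ('D_1 phi) 0 <= 2 * b.
Proof.
move=> dphi d2phi phi_le.
pose psi t := phi t - (a * t + b * t ^+ 2).
have [e /= e0 He] : exists2 e : R, 0 < e &
    forall t : R, `|t| < e -> derivable phi t 1 /\ psi t <= psi 0.
  have [e /= e0 He] := filterI dphi phi_le.
  exists e => // t te; have /= [] := He t; first by rewrite /ball_ /= sub0r normrN.
  by move=> ? le_t; split=> //; rewrite /psi; lra.
have dpsi (t : R) : `|t| < e ->
    is_derive t (1 : R) psi ('D_1 phi t - (a + 2 * b * t)).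
  move=> /He[dt _].
  have phi' : is_derive t (1 : R) phi ('D_1 phi t) by exact: derivableP.
  apply: is_derive_eq; rewrite /GRing.scale /=; ring.
have crit : 'D_1 phi (0 : R) = a.
  have e2 : (0 : R) \in `](- e), e[ by rewrite in_itv /= oppr_lt0 e0.
  have mem (t : R) : t \in `](- e), e[ -> `|t| < e by rewrite in_itv /= -ltr_norml.
  have m0 : is_derive (0 : R) (1 : R) psi 0.
    apply: (@derive1_at_max _ _ (- e) e) => //; first lra.
      by move=> t /mem/dpsi[].
    by move=> t /mem/He[].
  have [_] := m0.
  have [_ ->] : is_derive (0 : R) (1 : R) psi ('D_1 phi 0 - (a + 2 * b * 0)).
    by apply: dpsi; rewrite normr0.
  by lra.
rewrite leNgt; apply/negP => lt_b.
have /cvgr_gt /(_ _ lt_b)[h /= h0 Hh] :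
  (h^-1 *: (('D_1 phi \o shift 0) (h *: 1) - 'D_1 phi 0)
    @[h --> (0 : R)^']) --> 'D_1 ('D_1 phi) (0 : R) by exact: d2phi.
pose k := Num.min (h / 2) (e / 2).
have k0 : 0 < k by rewrite lt_min !divr_gt0.
have kh : k < h by rewrite gt_min; apply/orP; left; lra.
have ke : k < e by rewrite gt_min; apply/orP; right; lra.
have te t : 0 <= t <= k -> `|t| < e.
  by move=> /andP[t0 tk]; rewrite ger0_norm //; lra.
have [||c] := @MVT R psi (fun t => 'D_1 phi t - (a + 2 * b * t)) 0 k k0.
- by move=> t; rewrite in_itv /= => /andP[t0 tk]; apply/dpsi/te; rewrite !ltW.
- apply: derivable_within_continuous => t; rewrite in_itv /= => tk.
  by have [] := dpsi t (te t tk).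
rewrite in_itv /= => /andP[c0 ck] mvt.
have [_] : derivable phi k 1 /\ psi k <= psi 0 by apply: He; rewrite gtr0_norm.
have := Hh c; rewrite /ball_ /= sub0r normrN gtr0_norm // crit addr0.
rewrite /GRing.scale /= mulr1 => /(_ (lt_trans ck kh)).
rewrite gt_eqF // => /(_ isT); rewrite ltr_pdivlMl // => slope.
suff : 0 < psi k - psi 0 by lra.
by rewrite mvt pmulr_rgt0; lra.
Qed.

(** * Touching by a quadratic polynomial and the Laplacian *)

Section second_partials.
Context {R : realType}.
Variable n : nat.
Implicit Types (f : 'rV[R]_n -> R) (x v : 'rV[R]_n).

(** As the difference quotients are equal as functions, both the existence and
    the value of directional derivatives can be read on a line, to which the
    one-dimensional lemma applies. *)
Lemma line_quotient f x v (t : R) :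
  (fun h : R => h^-1 *:
    (((fun t : R => f (t *: v + x)) \o shift t) (h *: 1) - f (t *: v + x))) =
  (fun h : R => h^-1 *: ((f \o shift (t *: v + x)) (h *: v) - f (t *: v + x))).
Proof.
apply/funext => h /=.
by rewrite [h *: 1]mulr1 scalerDl addrA.
Qed.

Lemma derive_line f x v (t : R) :
  'D_1 (fun t : R => f (t *: v + x)) t = 'D_v f (t *: v + x).
Proof. by rewrite /derive line_quotient. Qed.

Lemma derivable_line f x v (t : R) :
  derivable (fun t : R => f (t *: v + x)) t 1 <-> derivable f (t *: v + x) v.
Proof. by rewrite /derivable line_quotient. Qed.

Lemma near_line x v (P : 'rV[R]_n -> Prop) :
  (\forall y \near x, P y) -> \forall t \near (0 : R), P (t *: v + x).
Proof.
move=> Px; have cv : (t *: v + x) @[t --> (0 : R)] --> 0 *: v + x.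
  by apply: cvgD; [exact: scalel_continuous|exact: cvg_cst].
by rewrite scale0r add0r in cv; exact: (cv _ Px).
Qed.

(** What the maximum principle uses of the smoothness of [f] at [x]. First
    derivatives have to exist near [x] and not only at [x], since ['D_v] is a
    total operator and [pderiv i f] is meaningful only where they do. Unlike
    smoothness on an open set, this involves finitely many derivatives and is
    directly seen to be stable under negation. *)
Definition twice_pderivable f x := forall i : 'I_n,
  (\forall y \near x, derivable f y (delta_mx ord0 i)) /\
  derivable (pderiv i f) x (delta_mx ord0 i).

Lemma smooth_on_twice_pderivable (U : set 'rV[R]_n) f x :
  open U -> smooth_on U f -> U x -> twice_pderivable f x.
Proof.
move=> oU sf Ux i; split; last by have [_] := sf [:: i] x Ux; exact.
near=> y; have [|_] := sf [::] y; last exact.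
by near: y; apply: open_nbhs_nbhs.
Unshelve. all: by end_near. Qed.

Lemma pderivN f x i : (\forall y \near x, derivable f y (delta_mx ord0 i)) ->
  \forall y \near x, - pderiv i f y = pderiv i (- f) y.
Proof. by apply: filterS => y dy; rewrite /pderiv deriveN. Qed.

Lemma twice_pderivableN f x : twice_pderivable f x -> twice_pderivable (- f) x.
Proof.
move=> df i; have [df1 df2] := df i; split.
  by apply: filterS df1 => y; exact: derivableN.
apply: (near_eq_derivable (f := - pderiv i f)); first exact: pderivN.
exact: derivableN.
Qed.

Lemma laplacianN f x :
  twice_pderivable f x -> laplacian (- f) x = - laplacian f x.
Proof.
move=> df; rewrite /laplacian -sumrN; apply: eq_bigr => i _ /=.
have [df1 df2] := df i; rewrite -[RHS]deriveN//.
by apply/esym/near_eq_derive; exact: pderivN.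
Qed.

(** The square of the Euclidean distance, a quadratic polynomial, whereas the
    distance from which [ball] is built is the sup one and is not smooth. *)
Definition sqdist (x y : 'rV[R]_n) : R := \sum_(i < n) (y ord0 i - x ord0 i) ^+ 2.

Lemma sqdistxx x : sqdist x x = 0.
Proof. by rewrite /sqdist big1 // => i _; rewrite subrr expr0n. Qed.

Lemma sqdist_ge0 x y : 0 <= sqdist x y.
Proof. by apply: sumr_ge0 => i _; exact: sqr_ge0. Qed.

Lemma sqdist_line x y i (t : R) : sqdist x (t *: delta_mx ord0 i + y) =
  sqdist x y + 2 * (y ord0 i - x ord0 i) * t + t ^+ 2.
Proof.
rewrite /sqdist (bigD1 i) //= [in RHS](bigD1 i) //=.
rewrite (eq_bigr (fun j => (y ord0 j - x ord0 j) ^+ 2)).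
  by rewrite !mxE !eqxx mulr1; ring.
by move=> j ji; rewrite !mxE eqxx (negbTE ji) mulr0 add0r.
Qed.

(** The maximum principle. Along the [i]-th axis the hypothesis bounds [f] by
    a parabola with leading coefficient [c], so each second partial derivative
    is at most [2 * c]. The case [c = 0] is that of a local maximum. *)
Lemma laplacian_le_of_touching f x0 x (c : R) : twice_pderivable f x ->
    (\forall y \near x, f y - c * sqdist x0 y <= f x - c * sqdist x0 x) ->
  laplacian f x <= n%:R * (2 * c).
Proof.
move=> df f_le; rewrite -[n in n%:R]card_ord -sum1_card natr_sum mulr_suml.
apply: ler_sum => i _; rewrite mul1r; have [df1 df2] := df i.
pose e : 'rV[R]_n := delta_mx ord0 i.
pose phi (t : R) := f (t *: e + x).
have Dphi : 'D_1 phi = fun t => pderiv i f (t *: e + x).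
  by apply/funext => t; exact: derive_line.
suff : 'D_1 ('D_1 phi) 0 <= 2 * c by rewrite Dphi derive_line scale0r add0r.
apply: (@second_derivative_le R phi (c * (2 * (x ord0 i - x0 ord0 i)))).
- by apply: filterS (near_line e df1) => t; exact: (derivable_line f x e t).2.
- by rewrite Dphi; apply/derivable_line; rewrite scale0r add0r.
- apply: filterS (near_line e f_le) => t.
  by rewrite /phi scale0r add0r sqdist_line; lra.
Qed.

Lemma continuous_sqdist x0 : continuous (sqdist x0).
Proof.
apply: (@continuous_big _ _ +%R) => [|i _ x]; first exact: add_continuous.
have cB : (y ord0 i - x0 ord0 i) @[y --> x] --> x ord0 i - x0 ord0 i.
  by apply: cvgB; [exact: coord_continuous|exact: cvg_cst].
exact: (cvg_comp _ _ cB (@exprn_continuous R 2 (x ord0 i - x0 ord0 i))).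
Qed.

(** Balls being cubes, the Euclidean ball of radius [s] lies inside. *)
Lemma sqdist_ge x y (s : R) : 0 < s -> ~ ball x s y -> s ^+ 2 <= sqdist x y.
Proof.
move=> s0 xy; rewrite leNgt; apply/negP => lt_s; apply: xy; split=> // i j.
rewrite (ord1 i); apply: (_ : `|x ord0 j - y ord0 j| < s).
rewrite distrC -(ltr_pXn2r (ltn0Sn 1)) ?nnegrE ?normr_ge0 ?(ltW s0)//.
rewrite real_normK ?num_real//; apply: le_lt_trans lt_s.
by rewrite /sqdist (bigD1 j) //= lerDl sumr_ge0 // => k _; exact: sqr_ge0.
Qed.

Lemma compact_closed_ball_rV x (s : R) : compact (closed_ball x s).
Proof.
have [s0|s0] := leP s 0; first by rewrite closed_ball0//; exact: compact0.
apply: bounded_closed_compact; last exact: closed_ball_closed.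
exists (`|x| + s); split; first exact: num_real.
move=> r rs y; rewrite closed_ballE // /closed_ball_ /= => xys.
rewrite -[y](subKr x); apply: le_trans (ler_normB _ _) _.
by apply: le_trans (ltW rs); rewrite lerD2l.
Qed.

(** On the boundary of the cube the penalty is at least [c * s ^+ 2 = 3 * A],
    more than the oscillation of [f], which is at most [2 * A]: the maximum of
    [f - c * sqdist x0] over the closed cube is therefore inside. *)
Lemma quadratic_touching f x0 (s A : R) : 0 < s -> 0 < A ->
    {within closed_ball x0 s, continuous f} ->
    (forall y, closed_ball x0 s y -> `|f y| <= A) ->
  let c := 3 * A / s ^+ 2 in
  exists x, [/\ ball x0 s x, f x0 <= f x &
    \forall y \near x, f y - c * sqdist x0 y <= f x - c * sqdist x0 x].
Proof.
move=> s0 A0 cf fA c; have c0 : 0 < c by rewrite divr_gt0 ?mulr_gt0 ?exprn_gt0.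
have x0B : closed_ball x0 s x0 by exact: closed_ballxx.
have [|||x] := @EVT_max_rV R n (f - (fun y => c * sqdist x0 y)) (closed_ball x0 s).
- by exists x0.
- exact: compact_closed_ball_rV.
- apply: within_continuousB => //; apply: continuous_subspaceT => y.
  exact: (cvgM (cvg_cst c) (@continuous_sqdist x0 y)).
rewrite inE /= => xB xmax.
have x0x : f x0 <= f x - c * sqdist x0 x.
  by have := xmax x0 (mem_set x0B); rewrite !fctE sqdistxx mulr0 subr0.
have xs : ball x0 s x.
  apply: contrapT => /(sqdist_ge s0) sx.
  have : 3 * A <= c * sqdist x0 x.
    have -> : 3 * A = c * s ^+ 2 by rewrite /c divfK // gt_eqF ?exprn_gt0.
    by rewrite ler_pM2l.
  have := fA _ x0B; have := fA _ xB; rewrite !ler_norml; lra.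
exists x; split=> //.
  by apply: le_trans x0x _; rewrite gerBl mulr_ge0 ?(ltW c0) ?sqdist_ge0.
have : nbhs x (ball x0 s) by apply: open_nbhs_nbhs; split=> //; exact: ball_open.
apply: filterS => y /(@subset_closed_ball _ _ _ _ _) yB.
by have := xmax y (mem_set yB); rewrite !fctE.
Qed.

End second_partials.

(** * Lebesgue measure of open sets *)

Section lebesgue_rV.
Context {R : realType}.

Lemma measurable_ball_rV n (c : 'rV[R]_n) (r : R) : measurable (ball c r).
Proof.
have [r0|r0] := leP r 0; first by rewrite le0_ball0.
have -> : ball c r =
    \bigcap_(i in [set: 'I_n]) (fun x => x ord0 i) @^-1` ball (c ord0 i) r.
  apply/seteqP; split=> [x [_ cx] i _|x cx]; first exact: cx.
  by split=> // i j; rewrite (ord1 i); exact: cx.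
apply: fin_bigcap_measurable => // i _; rewrite -[X in measurable X]setTI.
by apply: (measurable_coord i) => //; exact: measurable_realfun.measurable_ball.
Qed.

(** A cube of dimension [n + 1] is the preimage of an interval times a cube of
    dimension [n]. *)
Lemma lebesgue_rV_ball n (c : 'rV[R]_n) (r : R) : 0 < r ->
  (0 < lebesgue_rV R n (ball c r) < +oo)%E.
Proof.
move=> r0; elim: n c => [|n ih] c /=.
  rewrite diracE mem_set ?lte01 ?ltry//.
  by split=> // i [].
rewrite /cons_measure /pushforward.
have -> : @cons_rV R n @^-1` ball c r =
    ball (c ord0 ord0) r `*` ball (\row_j c ord0 (lift ord0 j)) r.
  apply/seteqP; split=> [[a x] [_ cx]|[a x] [/= ca [_ cx]]].
    split=> /=.
      by have := cx ord0 ord0; rewrite mxE unlift_none.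
    split=> // i j; have := cx ord0 (lift ord0 j).
    by rewrite !mxE liftK (ord1 i).
  split=> // i j; rewrite (ord1 i) mxE.
  case: unliftP => [k ->|-> //] /=.
  by have := cx ord0 k; rewrite mxE.
rewrite product_measure1E;
  [|exact: measurable_realfun.measurable_ball|exact: measurable_ball_rV].
rewrite [X in (X * _)%E](_ : _ = (r *+ 2)%:E); last first.
  exact: lebesgue_measure_ball (ltW r0).
have /andP[pos fin] := ih (\row_j c ord0 (lift ord0 j)).
by rewrite mule_gt0 ?lte_fin ?mulrn_wgt0//= lte_mul_pinfty ?lee_fin ?mulrn_wge0 ?ltW.
Qed.

(** The sigma-algebra on ['rV[R]_n] is the product one, whereas the topology is
    that of cubes: an open set is the union of the cubes that it contains with
    rational centre and radius [1 / (k + 1)], and these are countably many. *)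
Lemma open_measurable_rV n (U : set 'rV[R]_n) : open U -> measurable U.
Proof.
move=> oU.
pose B (p : 'rV[rat]_n * nat) : set 'rV[R]_n :=
  ball (map_mx ratr p.1 : 'rV[R]_n) p.2.+1%:R^-1.
have -> : U = \bigcup_p (if `[< B p `<=` U >] then B p else set0).
  apply/seteqP; split=> [x Ux|x [p _]]; last by case: asboolP => // pU /pU.
  have /nbhs_ballP[r /= r0 xU] : nbhs x U by exact: open_nbhs_nbhs.
  have [k kr] : exists k : nat, k.+1%:R^-1 < r / 2.
    near \oo => k; exists k; near: k.
    by apply: (near_infty_natSinv_lt (PosNum (divr_gt0 r0 (ltr0Sn _ 1)))).
  have k0 : 0 < k.+1%:R^-1 :> R by rewrite invr_gt0.
  have /choice[q qx] : forall i : 'I_n, exists q : rat,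
      `|x ord0 i - ratr q| < k.+1%:R^-1.
    move=> i; have [|q] := @rat_in_itvoo R (x ord0 i - k.+1%:R^-1) (x ord0 i + k.+1%:R^-1).
      by rewrite ltrD2l gtrN.
    rewrite in_itv /= => /andP[q1 q2]; exists q.
    by rewrite ltr_distlC q1.
  pose c : 'rV[rat]_n := \row_i q i.
  have cx : B (c, k) x.
    split=> // i j; rewrite (ord1 i) !mxE; apply: (_ : `|_ - _| < _).
    by rewrite distrC.
  exists (c, k) => //=; case: asboolP => // -[]; apply: subset_trans xU => y cy.
  rewrite [r]splitr; apply: ball_triangle (_ : ball x (r / 2) _) (_ : ball _ (r / 2) y).
    by apply/ball_sym; apply: le_ball cx; exact: ltW.
  by apply: le_ball cy; exact: ltW.
apply: countable_bigcupT_measurable => [|p]; first exact: countableP.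
by case: ifP => _ //; exact: measurable_ball_rV.
Unshelve. all: by end_near. Qed.

Lemma continuous_measurable_rV n (U : set 'rV[R]_n) (f : 'rV[R]_n -> R) :
  open U -> {in U, continuous f} -> measurable_fun U f.
Proof.
move=> oU cf; apply: (measurability _ (measurable_realfun.RGenOInfty.measurableE R)).
move=> /= _ [_ [a ->]] <-; apply: open_measurable_rV.
rewrite openE => x [Ux fx]; apply: filterI; first exact: open_nbhs_nbhs.
apply: (cf x (mem_set Ux)); apply: open_nbhs_nbhs; split; [exact: interval_open|exact: fx].
Qed.

Lemma lebesgue_rV_bounded_open n (U : set 'rV[R]_n) :
  open U -> U !=set0 -> bounded_set U -> (0 < lebesgue_rV R n U < +oo)%E.
Proof.
move=> oU [x Ux] [M [Mreal UM]]; have mU := open_measurable_rV oU.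
have /nbhs_ballP[r /= r0 xU] : nbhs x U by exact: open_nbhs_nbhs.
have /andP[+ _] := lebesgue_rV_ball x r0.
move=> /lt_le_trans -> /=; last first.
  by apply: le_measure => //; rewrite inE //; exact: measurable_ball_rV.
have M0 : 0 < `|M| + 2 by rewrite ltr_wpDl.
have /andP[_] := lebesgue_rV_ball (0 : 'rV[R]_n) M0.
apply: le_lt_trans; apply: le_measure; rewrite ?inE //.
  exact: measurable_ball_rV.
move=> y Uy; rewrite -ball_normE /= sub0r normrN.
apply: (@le_lt_trans _ _ (`|M| + 1)); last by rewrite ltrD2l ltr1n.
by apply: UM => //; rewrite (le_lt_trans (ler_norm M))// ltrDl.
Qed.

Lemma Rintegral_expR_bounds n (U : set 'rV[R]_n) (f : 'rV[R]_n -> R) (a b : R) :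
    open U -> bounded_set U -> U !=set0 -> {in U, continuous f} ->
    (forall x, U x -> a <= f x <= b) ->
  expR a * fine (lebesgue_rV R n U) <= \int[lebesgue_rV R n]_(x in U) expR (f x)
    <= expR b * fine (lebesgue_rV R n U).
Proof.
move=> oU bU U0 cf fab; have mU := open_measurable_rV oU.
have /andP[_ Uoo] := lebesgue_rV_bounded_open oU U0 bU.
have icst k : (lebesgue_rV R n).-integrable U (EFin \o (fun=> k)).
  apply: measurable_bounded_integrable => //.
  by exists `|k|; split => // M kM x _; exact: ltW.
have iexp : (lebesgue_rV R n).-integrable U (EFin \o (fun x => expR (f x))).
  apply: measurable_bounded_integrable => //.
    apply: continuous_measurable_rV => // x Ux.
    exact: (cvg_comp _ _ (cf x Ux) (@continuous_expR R (f x))).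
  exists (expR b); split => // M bM x Ux.
  rewrite /= gtr0_norm ?expR_gt0//.
  by rewrite (le_trans _ (ltW bM))// ler_expR; have /andP[] := fab x Ux.
rewrite -!Rintegral_cst//; apply/andP; split; apply: le_Rintegral => // x Ux;
  by rewrite ler_expR; have /andP[] := fab x Ux.
Qed.

End lebesgue_rV.

(** * Interior estimate *)

(** The touching point [x] satisfies [u x0 <= u x], so [f (u x0) >= f (u x)],
    and [f (u x)] is [- eps] times a Laplacian that is bounded above. *)
Lemma interior_estimate_ge (R : realType) n (u : 'rV[R]_n -> R) (x0 : 'rV[R]_n)
    (s A eps : R) (f : R -> R) : 0 < s -> 0 < A -> 0 < eps ->
    {homo f : a b /~ a <= b} ->
    {within closed_ball x0 s, continuous u} ->
    (forall y, closed_ball x0 s y -> `|u y| <= A) ->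
    (forall y, ball x0 s y -> twice_pderivable u y) ->
    (forall y, ball x0 s y -> - eps * laplacian u y = f (u y)) ->
  - (eps * (n%:R * (2 * (3 * A / s ^+ 2)))) <= f (u x0).
Proof.
move=> s0 A0 eps0 f_dec cu uA du eq_u.
have [x [xs ux touch]] := quadratic_touching s0 A0 cu uA.
apply: le_trans (f_dec _ _ ux); rewrite -eq_u // mulNr lerN2 ler_pM2l //.
exact: laplacian_le_of_touching (du x xs) touch.
Qed.

(** The upper bound is the lower one for [- u], which solves the equation with
    the nonincreasing right-hand side [t |-> - f (- t)]. *)
Lemma interior_estimate (R : realType) n (u : 'rV[R]_n -> R) (x0 : 'rV[R]_n)
    (s A eps : R) (f : R -> R) : 0 < s -> 0 < A -> 0 < eps ->
    {homo f : a b /~ a <= b} ->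
    {within closed_ball x0 s, continuous u} ->
    (forall y, closed_ball x0 s y -> `|u y| <= A) ->
    (forall y, ball x0 s y -> twice_pderivable u y) ->
    (forall y, ball x0 s y -> - eps * laplacian u y = f (u y)) ->
  `|f (u x0)| <= eps * (n%:R * (2 * (3 * A / s ^+ 2))).
Proof.
move=> s0 A0 eps0 f_dec cu uA du eq_u; rewrite ler_norml.
apply/andP; split; first exact: (interior_estimate_ge s0 A0 eps0 f_dec cu uA du eq_u).
have := @interior_estimate_ge R n (- u) x0 s A eps (fun t => - f (- t)) s0 A0 eps0.
rewrite /= -[(- u) x0]/(- u x0) opprK lerN2; apply.
- by move=> a b ab; rewrite lerN2; apply: f_dec; rewrite lerN2.
- by move=> y; apply: cvgN; exact: cu.
- by move=> y /uA; rewrite -[(- u) y]/(- u y) normrN.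
- by move=> y /du; exact: twice_pderivableN.
- move=> y ys; rewrite laplacianN; last exact: du.
  by rewrite -[(- u) y]/(- u y) opprK -eq_u// mulrN.
Qed.

(** * Bound on the solutions, uniform in the permittivity *)

Lemma compact_closure_rV (R : realType) n (U : set 'rV[R]_n) :
  bounded_set U -> compact (closure U).
Proof.
move=> [M [Mreal UM]].
apply: (subclosed_compact _ (@compact_closed_ball_rV R n 0 (`|M| + 2))).
  exact: closed_closure.
apply: closureS => y Uy; rewrite -ball_normE /= sub0r normrN.
apply: (@le_lt_trans _ _ (`|M| + 1)); last by rewrite ltrD2l ltr1n.
by apply: UM => //; rewrite (le_lt_trans (ler_norm M))// ltrDl.
Qed.

Section poisson_boltzmann_bounds.
Context {R : realType} {d : nat}.
Variables (Omega : set 'rV[R]_d) (W : 'rV[R]_d -> R) (Z1 I2 : R).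
Hypotheses (Omega_open : open Omega) (Omega_bounded : bounded_set Omega).
Hypotheses (Z1_gt0 : 0 < Z1) (I2_gt0 : 0 < I2).

(** Makes the interior estimate uniform in [eps]. The number [l] is the constant
    solution of the equation with no boundary condition: it balances
    [expR (- l) / Z1] and [I2] divided by the measure of [Omega]. *)
Lemma PB_solution_bounds (eps : R) Phi (M : R) : 0 < eps ->
    PB_solution Z1 I2 Omega W eps Phi ->
    (forall x, boundary Omega x -> `|W x| <= M) ->
    let l := ln (fine (lebesgue_rV R d Omega) / (Z1 * I2)) in
  forall x, Omega x -> `|Phi x| <= `|M| + `|l|.
Proof.
move=> eps0 [[sPhi cPhi _] eq_Phi bdry] WM l x Ox.
have clO : Omega `<=` closure Omega by exact: subset_closure.
have nz : closure Omega !=set0 by exists x; exact: clO.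
have cO := compact_closure_rV Omega_bounded.
have [x1] := EVT_max_rV nz cO cPhi; rewrite inE => x1O x1max.
have [x2] := EVT_min_rV nz cO cPhi; rewrite inE => x2O x2min.
have {x1max}max y : Omega y -> Phi y <= Phi x1 by move/clO/mem_set/x1max.
have {x2min}min y : Omega y -> Phi x2 <= Phi y by move/clO/mem_set/x2min.
have bdryP y : closure Omega y -> ~ Omega y -> `|Phi y| <= M.
  move=> yO nOy; have yb : boundary Omega y.
    by split=> //; rewrite (interior_id _).1.
  by rewrite bdry //; exact: WM.
set V := fine (lebesgue_rV R d Omega) in l *.
have V0 : 0 < V.
  apply: fine_gt0; apply: lebesgue_rV_bounded_open => //; exists x => //.
have cont : {in Omega, continuous Phi}.
  by move=> y; rewrite inE => Oy; have [] := sPhi [::] y Oy.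
pose C := \int[lebesgue_rV R d]_(y in Omega) expR (Phi y).
have /andP[C_ge C_le] : expR (Phi x2) * V <= C <= expR (Phi x1) * V.
  apply: Rintegral_expR_bounds => //; first by exists x.
  by move=> y Oy; rewrite min ?max.
have C0 : 0 < C by apply: lt_le_trans C_ge; rewrite mulr_gt0 ?expR_gt0.
have exp_l : expR l = V / I2 / Z1.
  by rewrite /l lnK ?posrE ?divr_gt0 ?mulr_gt0// invfM mulrA mulrAC.
(* At an interior maximum [0 <= rho], and [C] is at most [V * expR (Phi x1)]. *)
have up : Phi x1 <= `|M| + `|l|.
  have [Ox1|nO] := pselect (Omega x1); last first.
    have := bdryP _ x1O nO; have := ler_norm (Phi x1); have := ler_norm M.
    by have := normr_ge0 l; lra.
  suff : Phi x1 <= l by have := ler_norm l; have := normr_ge0 M; lra.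
  have lap : laplacian Phi x1 <= 0.
    rewrite -[leRHS](mulr0 d%:R) -[X in _ * X](mulr0 2).
    apply: (@laplacian_le_of_touching _ _ _ x1).
      exact: smooth_on_twice_pderivable sPhi Ox1.
    have : nbhs x1 Omega by exact: open_nbhs_nbhs.
    by apply: filterS => y Oy; rewrite !mul0r !subr0 max.
  have : 0 <= charge_density Z1 I2 Omega Phi x1.
    by rewrite -eq_Phi // mulr_le0 // oppr_le0 ltW.
  rewrite /charge_density -/C subr_ge0 => rho.
  have : I2 / V <= expR (- Phi x1) / Z1.
    apply: le_trans rho; rewrite ler_pM2l // ler_pdivlMr // mulrC.
    by rewrite ler_pdivrMr.
  rewrite -(ler_expR (Phi x1)) exp_l expRN -invfM -[I2 / V]invf_div.
  rewrite lef_pV2 ?posrE; [|exact: divr_gt0|by rewrite mulr_gt0 ?expR_gt0].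
  by move=> E_le; rewrite ler_pdivlMr.
(* At an interior minimum [rho <= 0], and [C] is at least [V * expR (Phi x2)]. *)
have lo : - (`|M| + `|l|) <= Phi x2.
  have [Ox2|nO] := pselect (Omega x2); last first.
    have := bdryP _ x2O nO; rewrite ler_norml; have := ler_norm M.
    by have := normr_ge0 l; lra.
  suff : l <= Phi x2 by have := ler_norm (- l); rewrite normrN; have := normr_ge0 M; lra.
  have du2 := smooth_on_twice_pderivable Omega_open sPhi Ox2.
  have lap : 0 <= laplacian Phi x2.
    rewrite -oppr_le0 -laplacianN // -[leRHS](mulr0 d%:R) -[X in _ * X](mulr0 2).
    apply: (@laplacian_le_of_touching _ _ _ x2); first exact: twice_pderivableN.
    have : nbhs x2 Omega by exact: open_nbhs_nbhs.
    by apply: filterS => y Oy; rewrite !mul0r !subr0 lerN2 min.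
  have : charge_density Z1 I2 Omega Phi x2 <= 0.
    by rewrite -eq_Phi // mulr_le0_ge0 // oppr_le0 ltW.
  rewrite /charge_density -/C subr_le0 => rho.
  have : expR (- Phi x2) / Z1 <= I2 / V.
    apply: le_trans rho _; rewrite ler_pM2l // ler_pdivrMr // mulrC.
    by rewrite ler_pdivlMr.
  rewrite -(ler_expR l) exp_l expRN -invfM -[I2 / V]invf_div.
  rewrite lef_pV2 ?posrE; [|by rewrite mulr_gt0 ?expR_gt0|exact: divr_gt0].
  by move=> E_ge; rewrite ler_pdivrMr.
by rewrite ler_norml (le_trans lo (min _ Ox)) (le_trans (max _ Ox) up).
Qed.

End poisson_boltzmann_bounds.

(** * Convergence on compact subsets *)

Lemma compact_closed_ball_subset (R : realType) n (K U : set 'rV[R]_n) :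
  compact K -> open U -> K `<=` U ->
  exists2 s : R, 0 < s & forall x, K x -> closed_ball x s `<=` U.
Proof.
move=> /compact_near_coveringP cK oU KU.
have [] := cK R (0^'+) (fun e x => ball x e `<=` U) _.
- move=> x /KU Ux; have /nbhs_ballP[r /= r0 xU] : nbhs x U by exact: open_nbhs_nbhs.
  exists (ball x (r / 2), [set e | e < r / 2]) => /=.
    by split; [exact: nbhsx_ballx (divr_gt0 _ _)|exact: nbhs_right_lt (divr_gt0 _ _)].
  move=> [y e] /= [xy er] z yz; apply: xU; rewrite [r]splitr.
  by apply: ball_triangle xy _; apply: le_ball yz; exact: ltW.
move=> e /= e0 He; exists (e / 4); first by rewrite divr_gt0.
move=> x Kx y xy.
have e2 : 0 < e / 2 by rewrite divr_gt0.
apply: (He (e / 2) _ _ x Kx) => //=.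
  by rewrite sub0r normrN gtr0_norm //; lra.
apply: closed_ball_subset xy; lra.
Qed.

Theorem theorem3 (R : realType) (d : nat) (hd : d = 2%N \/ d = 3%N)
    (Omega : set 'rV[R]_d)
    (Omega_open : open Omega) (Omega_connected : connected Omega)
    (Omega_bounded : bounded_set Omega) (Omega_smooth : smooth_boundary Omega)
    (W : 'rV[R]_d -> R) (W_smooth : smooth_on_subset (boundary Omega) W)
    (Z1 I2 : R) (Z1_gt0 : 0 < Z1) (I2_gt0 : 0 < I2)
    (Phi : R -> 'rV[R]_d -> R)
    (Phi_sol : forall eps : R, 0 < eps ->
      PB_solution Z1 I2 Omega W eps (Phi eps))
    (K : set 'rV[R]_d) (K_compact : compact K) (K_sub : K `<=` Omega) :
  sup_abs K (charge_density Z1 I2 Omega (Phi eps)) @[eps --> 0^'+] --> 0%E.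
Proof.
have [s s0 KO] := compact_closed_ball_subset K_compact Omega_open K_sub.
have [M WM] : exists M, forall x, boundary Omega x -> `|W x| <= M.
  have [[_ cPhi _] _ bdry] := Phi_sol 1 ltr01.
  have cO := compact_closure_rV Omega_bounded.
  have [M [_ PhiM]] := compact_bounded (continuous_compact cPhi cO).
  exists (M + 1) => x [xO nxO]; rewrite -bdry//.
  by apply: (PhiM (M + 1)); [rewrite ltrDl|exists x].
(* The final [1] makes [A] positive, as [interior_estimate] requires. *)
pose A := `|M| + `|ln (fine (lebesgue_rV R d Omega) / (Z1 * I2))| + 1.
have A0 : 0 < A by rewrite ltr_wpDl// addr_ge0.
pose c := d%:R * (2 * (3 * A / s ^+ 2)).
have rho_le eps x : 0 < eps -> K x ->
    `|charge_density Z1 I2 Omega (Phi eps) x| <= eps * c.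
  move=> eps0 Kx; have sol := Phi_sol _ eps0; have [[sPhi _ _] eq_Phi _] := sol.
  have ballO y : ball x s y -> Omega y.
    by move=> /(@subset_closed_ball _ _ _ _ _); exact: KO.
  (* [0 <= C] makes the right-hand side a nonincreasing function of [Phi]. *)
  pose C := \int[lebesgue_rV R d]_(y in Omega) expR (Phi eps y).
  have C0 : 0 <= C by apply: Rintegral_ge0 => y _; exact: expR_ge0.
  apply: (@interior_estimate R d (Phi eps) x s A eps
    (fun t => expR (- t) / Z1 - I2 * (expR t / C))) => //.
  - move=> a b ab; apply: lerB.
      by rewrite ler_pM2r ?invr_gt0// ler_expR lerN2.
    by rewrite ler_pM2l// ler_wpM2r ?invr_ge0// ler_expR.
  - apply: continuous_in_subspaceT => y; rewrite inE => /(KO x Kx) Oy.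
    by have [] := sPhi [::] y Oy.
  - move=> y /(KO x Kx) Oy; rewrite /A ler_wpDr//.
    exact: (PB_solution_bounds Omega_open Omega_bounded _ _ eps0 sol).
  - by move=> y /ballO; exact: smooth_on_twice_pderivable.
  - by move=> y /ballO; exact: eq_Phi.
apply: (@squeeze_cvge _ _ _ _ (cst 0%E) _ (fun eps => (eps * c)%:E)).
- near=> eps; have eps0 : 0 < eps by near: eps; exact: nbhs_right_gt.
  rewrite /sup_abs le_max lexx /= ge_max lee_fin.
  have c0 : 0 <= c by rewrite mulr_ge0// mulr_ge0// divr_ge0 ?mulr_ge0 ?exprn_ge0// ltW.
  rewrite mulr_ge0 ?(ltW eps0)//=.
  by apply: ge_ereal_sup => _ [x Kx <-]; rewrite lee_fin rho_le.
- exact: cvg_cst.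
- apply: cvg_EFin; first by near=> eps.
  rewrite -[X in _ --> X](mul0r c).
  apply: cvgM; last exact: cvg_cst.
  exact: cvg_at_right_filter cvg_id.
Unshelve. all: by end_near. Qed.
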